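(* Let $A$ be an algebra and consider a resolution of length one of the Hilbert module $\mathcal{M}_0$ over $A$: \[ 0 \longleftarrow \mathcal{M}_0 \overset{X_0}{\longleftarrow} \mathcal{M}_1 \overset{X_1}{\longleftarrow} \mathcal{M}_2 \longleftarrow 0 . \] If $\mathcal{M}_1$ and $\mathcal{M}_2$ are essentially reductive and $X_0^*$ is an isometry, then $\mathcal{M}_0$ is essentially reductive.
   Context: A Hilbert module over a complex algebra $A$ is a complex Hilbert space $\mathcal{M}$ that is a module over $A$ such that for each $\varphi\in A$ the module multiplication $M_\varphi f=\varphi\cdot f$ is a bounded operator on $\mathcal{M}$. It is essentially reductive if for every $\varphi\in A$ the self-commutator $[M_\varphi^*,M_\varphi]=M_\varphi^*M_\varphi-M_\varphi M_\varphi^*$ is compact. A module map is a bounded linear operator between Hilbert modules over $A$ that intertwines the actions of $A$. A resolution of length one of $\mathcal{M}_0$ consists of Hilbert modules $\mathcal{M}_1,\mathcal{M}_2$ over $A$ and module maps $X_0:\mathcal{M}_1\to\mathcal{M}_0$ and $X_1:\mathcal{M}_2\to\mathcal{M}_1$ such that $\operatorname{range}(X_0)=\mathcal{M}_0$, $\ker(X_1)=(0)$ and $\operatorname{range}(X_1)=\ker(X_0)$. *)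

(* Defs.v *)
From HB Require Import structures.
From mathcomp Require Import all_boot all_order all_algebra sesquilinear.
From mathcomp Require Import boolp classical_sets reals topology normedtype.
From mathcomp Require Import sequences complex ring.
Import Order.TTheory GRing.Theory Num.Theory Num.Def.
Import numFieldNormedType.Exports.
Set Implicit Arguments.
Unset Strict Implicit.
Unset Printing Implicit Defensive.
Local Open Scope classical_set_scope.
Local Open Scope ring_scope.

(* The norm, hence the topology for which the space is complete, is the one
   given by [inner], which is linear in its first argument and conjugate-linear
   in the second. *)
HB.mixin Record CompleteNormedModule_isHilbert (R : realType) (E : Type)
    of CompleteNormedModule R[i] E := {
  inner : {dot E for (@conjC R[i])} ;
  inner_norm : forall x : E, inner x x = `|x| ^+ 2
}.

#[short(type="hilbertType")]
HB.structure Definition Hilbert (R : realType) :=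
  {E of CompleteNormedModule_isHilbert R E & CompleteNormedModule R[i] E}.

Record boundedOp (R : realType) (E F : hilbertType R) := BoundedOp {
  bop_map :> {linear E -> F} ;
  bop_bounded : exists k : R[i], forall x, `|bop_map x| <= k * `|x|
}.

Section Adjoint.
Context {R : realType}.
Implicit Types E F : hilbertType R.

Lemma innerC E (x y : E) : inner x y = (inner y x)^*.
Proof. by rewrite hermC mul1r. Qed.

Lemma innerDl E (x y z : E) : inner (x + y) z = inner x z + inner y z.
Proof. exact: linearDl. Qed.

Lemma innerBl E (x y z : E) : inner (x - y) z = inner x z - inner y z.
Proof. exact: linearBl. Qed.

Lemma innerZl E a (x z : E) : inner (a *: x) z = a * inner x z.
Proof. exact: linearZl_LR. Qed.

Lemma innerDr E (x y z : E) : inner z (x + y) = inner z x + inner z y.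
Proof. exact: linearDr. Qed.

Lemma innerBr E (x y z : E) : inner z (x - y) = inner z x - inner z y.
Proof. exact: linearBr. Qed.

Lemma innerZr E a (x z : E) : inner z (a *: x) = a^* * inner z x.
Proof. exact: linearZr_LR. Qed.

Lemma inner0r E (z : E) : inner z 0 = 0.
Proof. exact: linear0r. Qed.

Lemma inner_ext E (x y : E) : (forall z, inner z x = inner z y) -> x = y.
Proof.
move=> h; apply/eqP; rewrite -subr_eq0 -normr_eq0.
suff : `|x - y| ^+ 2 == 0 by rewrite expf_eq0.
by rewrite -inner_norm innerBr h subrr.
Qed.

Lemma norm_innerD E (x y : E) :
  `|x + y| ^+ 2 = `|x| ^+ 2 + `|y| ^+ 2 + (inner x y + (inner x y)^*).
Proof. by rewrite -!inner_norm dnormD. Qed.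

Lemma norm_innerB E (x y : E) :
  `|x - y| ^+ 2 = `|x| ^+ 2 + `|y| ^+ 2 - (inner x y + (inner x y)^*).
Proof. by rewrite -!inner_norm dnormB. Qed.

Lemma inner_dist E (d : R[i]) (x u : E) :
  (forall t, d <= `|x - t *: u| ^+ 2) ->
  `|inner x u| ^+ 2 <= (`|x| ^+ 2 - d) * `|u| ^+ 2.
Proof.
move=> h; have [->|u0] := eqVneq u 0.
  by rewrite inner0r !normr0 expr0n /= mulr0.
have nu0 : `|u| ^+ 2 != 0 by rewrite expf_eq0 /= normr_eq0.
have := h (inner x u / `|u| ^+ 2); set t := _ / _.
rewrite norm_innerB innerZr normrZ exprMn.
have -> : (t^* * inner x u) + (t^* * inner x u)^* =
          (`|inner x u| ^+ 2 / `|u| ^+ 2) *+ 2.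
  have -> : t^* * inner x u = `|inner x u| ^+ 2 / `|u| ^+ 2.
    rewrite /t rmorphM /= fmorphV /= rmorphXn /= (CrealP (normr_real _)).
    by rewrite mulrAC mulrC [in RHS]normCK mulrC [_^* * _]mulrC.
  rewrite rmorphM /= fmorphV /= !rmorphXn /= !(CrealP (normr_real _)).
  by rewrite mulr2n.
rewrite /t normrM normfV normrX normr_id exprMn exprVn.
set a := `|inner x u| ^+ 2; set b := `|u| ^+ 2; set c := `|x| ^+ 2.
have -> : c + a / b ^+ 2 * b - a / b *+ 2 = c - a / b.
  have -> : a / b ^+ 2 * b = a / b by rewrite expr2 invfM -!mulrA mulVf // mulr1.
  by rewrite mulr2n opprD addrA addrK.
rewrite lerBrDl -lerBrDr ler_pdivrMr //.
by rewrite lt_def nu0 exprn_ge0.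
Qed.

Lemma cauchy_schwarz E (x y : E) : `|inner x y| <= `|x| * `|y|.
Proof.
rewrite -(@ler_pXn2r _ 2) ?nnegrE ?mulr_ge0 // exprMn.
by rewrite -[X in X * _]subr0; apply: inner_dist => t; rewrite exprn_ge0.
Qed.

Lemma parallelogram E (x y : E) :
  `|x - y| ^+ 2 = `|x| ^+ 2 *+ 2 + `|y| ^+ 2 *+ 2 - `|x + y| ^+ 2.
Proof.
rewrite norm_innerB norm_innerD.
by apply/eqP; rewrite -subr_eq0; apply/eqP; ring.
Qed.

Lemma small_eq0 (a M : R[i]) :
  (forall e, 0 < e -> `|a| <= e * M) -> a = 0.
Proof.
move=> h; apply/eqP; apply: contraT; rewrite -normr_gt0 => a0.
have M0 : 0 < M by have := h _ ltr01; rewrite mul1r; apply: lt_le_trans.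
have := h (`|a| / (M *+ 2)).
rewrite divr_gt0 // ?pmulrn_lgt0 // => /(_ isT).
rewrite -mulr_natr invfM mulrA mulrAC mulfVK ?gt_eqF // ler_pdivlMr //.
by rewrite ger_pMr // lern1.
Qed.

Lemma riesz E (phi : E -> R[i]) (k : R[i]) :
  (forall a x y, phi (a *: x + y) = a * phi x + phi y) ->
  (forall x, `|phi x| <= k * `|x|) ->
  exists z, forall x, phi x = inner x z.
Proof.
move=> lphi bphi.
have phiD x y : phi (x + y) = phi x + phi y by rewrite -[x]scale1r lphi mul1r scale1r.
have phi0 : phi 0 = 0 by apply/(addrI (phi 0)); rewrite -phiD !addr0.
have phiZ a x : phi (a *: x) = a * phi x by rewrite -[a *: x]addr0 lphi phi0 addr0.
have phiN x : phi (- x) = - phi x by rewrite -scaleN1r phiZ mulN1r.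
have [[x0 /eqP nx0]|nphi] := pselect (exists x, phi x <> 0); last first.
  exists 0 => x; rewrite inner0r; apply: contrapT => h; apply: nphi; by exists x.
pose S : set R := [set r | exists2 x, phi x = 1 & r%:C%C = `|x| ^+ 2].
have nS : S !=set0.
  exists (complex.Re (`|(phi x0)^-1 *: x0| ^+ 2)); exists ((phi x0)^-1 *: x0).
    by rewrite phiZ mulVf.
  by rewrite RRe_real // rpredX // normr_real.
have lS : has_lbound S.
  by exists 0 => r [x _ e]; rewrite -lecR e exprn_ge0.
pose d := inf S.
have dP x : phi x = 1 -> d%:C%C <= `|x| ^+ 2.
  move=> px; have r : `|x| ^+ 2 \is Num.real by rewrite rpredX // normr_real.
  by rewrite -(RRe_real r) lecR; apply: ge_inf => //; exists x => //; rewrite RRe_real.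
have ex (n : nat) : exists x, phi x = 1 /\ `|x| ^+ 2 <= d%:C%C + n.+1%:R^-1.
  have [| |r [x px e] h] := @inf_adherent _ S (n.+1%:R^-1).
  - by rewrite invr_gt0.
  - by split.
  exists x; split=> //; rewrite -e.
  have -> : n.+1%:R^-1 = (n.+1%:R^-1 : R)%:C%C by rewrite fmorphV rmorph_nat.
  by rewrite -rmorphD lecR ltW.
have [u uP] := choice ex.
have Narch (e : R[i]) : 0 < e -> exists N : nat, N.+1%:R^-1 < e.
  case: e => a b; rewrite ltcE /= => /andP[/eqP -> a0].
  exists (Num.truncn a^-1).
  have -> : (Num.truncn a^-1).+1%:R^-1 = ((Num.truncn a^-1).+1%:R^-1 : R)%:C%C.
    by rewrite fmorphV rmorph_nat.
  by rewrite ltcR -[ltRHS]invrK ltf_pV2 ?posrE ?invr_gt0 // truncnS_gt.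
have dist m n : `|u m - u n| ^+ 2 <= m.+1%:R^-1 *+ 2 + n.+1%:R^-1 *+ 2.
  have [pm hm] := uP m; have [pn hn] := uP n.
  rewrite parallelogram.
  have h : d%:C%C *+ 4 <= `|u m + u n| ^+ 2.
    have := dP (2^-1 *: (u m + u n)).
    rewrite phiZ phiD pm pn mulVf ?pnatr_eq0 // => /(_ erefl).
    rewrite normrZ exprMn normfV normr_nat exprVn ler_pdivlMl ?exprn_gt0 //.
    by rewrite -natrX mulr_natl.
  rewrite lerBlDr (le_trans _ (lerD (lexx _) h)) //.
  have hm2 := ler_wMn2r 2 hm; have hn2 := ler_wMn2r 2 hn.
  apply: (le_trans (lerD hm2 hn2)).
  by rewrite le_eqVlt; apply/orP; left; apply/eqP; ring.
have cu : cvg (u @ \oo).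
  apply/cauchy_cvgP/cauchy_exP => e e0.
  have [|N hN] := Narch (e ^+ 2 / 4); first by rewrite divr_gt0 // exprn_gt0.
  exists (u N); exists N => // n /= Nn.
  rewrite -ball_normE /= -(@ltr_pXn2r _ 2) ?nnegrE ?(ltW e0) //.
  apply: (le_lt_trans (dist _ _)); apply: (@le_lt_trans _ _ (N.+1%:R^-1 *+ 4)).
    rewrite (_ : 4 = 2 + 2)%N // mulrnDr lerD2l lerMn2r //.
    by rewrite lef_pV2 ?posrE // ler_nat.
  by move: hN; rewrite ltr_pdivlMr // mulr_natr.
pose z := lim (u @ \oo).
have uz (e : R[i]) : 0 < e -> exists m : nat, m.+1%:R^-1 <= e ^+ 2 /\ `|z - u m| <= e.
  move=> e0; have [|N hN] := Narch (e ^+ 2); first by rewrite exprn_gt0.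
  have /cvgrPdist_lt/(_ e e0)[M _ hM] := cu.
  exists (maxn M N); split; last by apply/ltW/hM; rewrite /= leq_maxl.
  by apply: le_trans (ltW hN); rewrite lef_pV2 ?posrE // ler_nat ltnS leq_maxr.
have pz : phi z = 1.
  apply/eqP; rewrite -subr_eq0; apply/eqP; apply: (@small_eq0 _ k) => e e0.
  have [m [_ hm]] := uz e e0.
  have [pm _] := uP m; rewrite -pm -phiN -phiD.
  apply: le_trans (bphi _) _.
  have [k0|k0] := boolP (0 <= k); first by rewrite mulrC ler_wpM2r.
  have : `|phi x0| <= k * `|x0| by [].
  move=> h; case/negP: k0.
  have x00 : 0 < `|x0| by rewrite normr_gt0; apply: contraNneq nx0 => ->; rewrite phi0.
  by rewrite -(pmulr_lge0 _ x00); apply: le_trans h.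
have oz n : phi n = 0 -> inner n z = 0.
  move=> pn; apply: (@small_eq0 _ (`|n| *+ 2)) => e e0.
  have [m [h1 h2]] := uz e e0; have [pm hm] := uP m.
  rewrite -[z](subrK (u m)) innerDr mulrnAr mulr2n.
  apply: le_trans (ler_normD _ _) _; apply: lerD.
    by apply: le_trans (cauchy_schwarz _ _) _; rewrite mulrC ler_wpM2r.
  rewrite innerC norm_conjC -(@ler_pXn2r _ 2) ?nnegrE ?mulr_ge0 ?(ltW e0) // exprMn.
  apply: (le_trans (@inner_dist _ d%:C%C _ _ _)).
    by move=> t; apply: dP; rewrite phiD -scaleNr phiZ pn mulr0 addr0.
  by rewrite ler_wpM2r ?exprn_ge0 // lerBlDl (le_trans hm) // lerD2l.
have z0 : `|z| ^+ 2 != 0.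
  rewrite expf_eq0 /= normr_eq0; apply: contra_eq_neq pz => ->.
  by rewrite phi0 eq_sym oner_eq0.
exists ((`|z| ^+ 2)^-1 *: z) => x.
have : inner (x - phi x *: z) z = 0.
  by apply: oz; rewrite phiD -scaleNr phiZ pz mulr1 subrr.
rewrite innerBl innerZl /= inner_norm => /eqP; rewrite subr_eq0 => /eqP e.
rewrite innerZr /= e rmorphV ?unitfE //= rmorphXn /= (CrealP (normr_real _)).
by rewrite mulrC mulfK.
Qed.

Lemma bop_bounded_ge0 E F (T : boundedOp E F) :
  exists2 k : R[i], 0 <= k & forall x, `|T x| <= k * `|x|.
Proof.
have [k bk] := bop_bounded T; exists `|k| => // x.
rewrite -[X in _ * X]normr_id -normrM ger0_norm //.
exact: le_trans (bk x).
Qed.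

Lemma adjoint_exists E F (T : boundedOp E F) :
  exists S : boundedOp F E, forall x y, inner (T x) y = inner x (S y).
Proof.
have [k k0 bk] := bop_bounded_ge0 T.
have ex y : exists z, forall x, inner (T x) y = inner x z.
  apply: (@riesz _ _ (k * `|y|)) => [a x1 x2|x].
    by rewrite linearP innerDl innerZl.
  apply: le_trans (cauchy_schwarz _ _) _.
  by rewrite mulrAC ler_wpM2r.
have [S SP] := choice ex.
have linS : linear S.
  move=> a y1 y2; apply: inner_ext => x.
  by rewrite -SP !innerDr !innerZr /= !SP.
pose SL : {linear F -> E} := HB.pack S (GRing.isLinear.Build _ _ _ _ S linS).
suff bS : exists k : R[i], forall y, `|SL y| <= k * `|y| by exists (BoundedOp bS).
exists k => y /=; have [->|Sy0] := eqVneq (S y) 0.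
  by rewrite normr0 mulr_ge0.
have Sy_gt0 : 0 < `|S y| by rewrite normr_gt0.
rewrite -(ler_pM2r Sy_gt0) -expr2 -inner_norm -SP.
have -> : inner (T (S y)) y = `|inner (T (S y)) y|.
  by rewrite SP inner_norm normrX normr_id.
apply: le_trans (cauchy_schwarz _ _) _.
by rewrite mulrAC ler_wpM2r.
Qed.
End Adjoint.

Definition adjoint (R : realType) (E F : hilbertType R) (T : boundedOp E F) :
  boundedOp F E := projT1 (cid (adjoint_exists T)).

Lemma adjointP (R : realType) (E F : hilbertType R) (T : boundedOp E F) x y :
  inner (T x) y = inner x (adjoint T y).
Proof. exact: projT2 (cid (adjoint_exists T)) x y. Qed.

Definition isometric (R : realType) (E F : hilbertType R)
  (T : {linear E -> F}) : Prop := forall x, `|T x| = `|x|.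

(* [precompact] means having compact closure, see [precompactE] *)
Definition compact_op (R : realType) (E F : hilbertType R)
  (T : {linear E -> F}) : Prop := precompact (T @` [set x | `|x| <= 1]).

Definition self_commutator (R : realType) (E : hilbertType R)
  (T : boundedOp E E) : {linear E -> E} :=
  (adjoint T \o T) \- (T \o adjoint T).

(* An associative algebra, not required to be commutative or to have a unit.
   MathComp's [algType] is unital; see [assocAlg_of_algType]. *)
Record assocAlg (K : nzRingType) := AssocAlg {
  alg_carrier :> lmodType K ;
  alg_mul : {bilinear alg_carrier -> alg_carrier -> alg_carrier} ;
  alg_mulA : associative alg_mul
}.

Section AssocAlgOfAlgType.
Variables (K : nzRingType) (B : algType K).

Let mul (a b : B) : B := a * b.

Fact mul_bilinear : bilinear_for *:%R *:%R mul.
Proof.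
split=> [b c a1 a2|a c b1 b2]; first by rewrite /mul mulrDl -scalerAl.
by rewrite /mul mulrDr -scalerAr.
Qed.

HB.instance Definition _ := bilinear_isBilinear.Build K B B B _ _ mul mul_bilinear.

Definition assocAlg_of_algType : assocAlg K :=
  @AssocAlg K B mul (@mulrA B).

End AssocAlgOfAlgType.

(* The module structure is presented by its multiplication operators
   [hm_mul a] : f |-> a . f.  A unit of [A], if any, is not required to act as
   the identity. *)
Record hilbertModule (R : realType) (A : assocAlg R[i]) := HilbertModule {
  hm_space :> hilbertType R ;
  hm_mul : A -> boundedOp hm_space hm_space ;
  hm_mulP : forall c a b f,
    hm_mul (c *: a + b) f = c *: hm_mul a f + hm_mul b f ;
  hm_mulM : forall a b f, hm_mul (alg_mul A a b) f = hm_mul a (hm_mul b f)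
}.

Definition essentially_reductive (R : realType) (A : assocAlg R[i])
  (M : hilbertModule A) : Prop :=
  forall a : A, compact_op (self_commutator (hm_mul M a)).

Record moduleMap (R : realType) (A : assocAlg R[i]) (M N : hilbertModule A) :=
  ModuleMap {
  mm_op :> boundedOp M N ;
  mm_mul : forall a f, mm_op (hm_mul M a f) = hm_mul N a (mm_op f)
}.

Definition resolution1 (R : realType) (A : assocAlg R[i])
  (M0 M1 M2 : hilbertModule A) (X0 : moduleMap M1 M0) (X1 : moduleMap M2 M1) :
  Prop :=
  [/\ range X0 = setT,
      X1 @^-1` [set 0] = [set 0] &
      range X1 = X0 @^-1` [set 0]].

(* Main.v *)
(* Let [T], [S], [N] be the multiplications by [a] on [M1], [M2], [M0] and let
   [P = 1 - X0* X0] be the projection onto [ker X0 = range X1].  Since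
   [X0 X0* = 1], [N = X0 T X0*] and
     [N* N - N N* = X0 (T* T - T T* ) X0* - (X0 T* P) T X0*],
   so it is enough that [X0 T* P] be compact.  Fuglede-Putnam modulo compact
   operators turns [T X1 = X1 S] into compactness of [T* X1 - X1 S*], hence of
   [X0 T* X1], because [X0 X1 = 0].  As [range X1] is closed, [X1 X1*] is bounded
   below on it (uniform boundedness), so [X0 T* P] is a norm limit of compact
   operators [X0 T* X1 B].
   Fuglede-Putnam is proved without the Calkin algebra: if [T Y - Y S] is
   compact and [D Y = T* Y - Y S*], then, modulo compact operators,
   [Y + z D Y = (1 + Q) Y (1 - L) + Q Y L] with [Q = z T* - z^* T] and
   [L = z S* - z^* S] skew-adjoint, so that [1 + z D] increases the essential
   norm by a factor at most [1 + C |z|^2]; the Cauchy estimate for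
   [(1 + z D / n)^n] then forces [D Y] to have essential norm [0]. *)
Require Import Defs.
From HB Require Import structures.
From mathcomp Require Import all_boot all_order all_algebra.
From mathcomp Require Import cyclic separable cyclotomic.
From mathcomp Require Import boolp classical_sets functions topology normedtype.
From mathcomp Require Import reals complex ring finmap.
Import Order.TTheory GRing.Theory Num.Theory Num.Def.
Import numFieldNormedType.Exports.
Set Implicit Arguments.
Unset Strict Implicit.
Unset Printing Implicit Defensive.
Local Open Scope classical_set_scope.
Local Open Scope ring_scope.

(** * Bernoulli's inequality, roots of unity and the archimedean property *)

Lemma bernoulli_mul (K : numDomainType) (x : K) n :
  -1 <= x -> (1 + x) ^+ n * (1 - n%:R * x) <= 1.
Proof.
move=> x1; have x1' : 0 <= 1 + x by rewrite -lerBlDl sub0r.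
have xr : x \is Num.real.
  by rewrite -(subrK (-1) x) rpredD ?rpredN ?rpred1 // ger0_real // opprK addrC.
elim: n => [|n ih]; first by rewrite expr0 mul0r subr0 mulr1.
apply: le_trans ih; rewrite exprSr -mulrA ler_wpM2l ?exprn_ge0 //.
rewrite -subr_ge0.
have -> : 1 - n%:R * x - (1 + x) * (1 - n.+1%:R * x) = n.+1%:R * x ^+ 2.
  by rewrite -natr1; ring.
by rewrite mulr_ge0 ?real_exprn_even_ge0.
Qed.

(** As [n] is nonzero in [F], the polynomial ['X^n - 1] is separable, so it has [n] distinct roots;
    they form a cyclic group. *)
Lemma prim_root_exists (F : closedFieldType) n :
  n%:R != 0 :> F -> exists z : F, n.-primitive_root z.
Proof.
move=> nF; have n0 : (0 < n)%N by case: n nF => //; rewrite eqxx.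
pose p : {poly F} := 'X^n - 1; have [r Dp] := closed_field_poly_normal p.
rewrite (monicP _) ?monicXnsubC // scale1r in Dp.
have rn1 : all n.-unity_root r by apply/allP => z; rewrite -root_prod_XsubC -Dp.
have sz_r : (n < (size r).+1)%N.
  by rewrite -(size_prod_XsubC r id) -Dp size_XnsubC.
have [|z] := hasP (has_prim_root n0 rn1 _ sz_r); last by exists z.
by rewrite -separable_prod_XsubC -Dp separable_Xn_sub_1.
Qed.

Lemma prim_root_sum (F : fieldType) n (w : F) k : n.-primitive_root w ->
  \sum_(j < n) w ^+ j ^+ k = if (n %| k)%N then n%:R else 0.
Proof.
move=> wn; under eq_bigr => j _ do rewrite exprAC.
rewrite (prim_order_dvd wn); case: eqP => [->|/eqP wk].
  by under eq_bigr => j _ do rewrite expr1n; rewrite sumr_const card_ord.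
apply: (mulfI (_ : w ^+ k - 1 != 0)); first by rewrite subr_eq0.
by rewrite mulr0 -subrX1 exprAC (prim_expr_order wn) expr1n subrr.
Qed.

Lemma complex_archimedean (R : realType) (x : R[i]) : 0 <= x ->
  exists n : nat, x < n%:R.
Proof.
(* In the order of [R[i]], [0 <= x] forces the imaginary part to vanish. *)
case: x => a b; rewrite lecE /= => /andP[/eqP -> a0].
exists (Num.truncn a).+1.
have -> : (Num.truncn a).+1%:R = ((Num.truncn a).+1%:R : R)%:C%C by rewrite rmorph_nat.
by rewrite ltcR truncnS_gt.
Qed.

(** * Total boundedness and precompactness *)

Section TotallyBounded.
Variables (R : realType) (E : completeNormedModType R[i]).

(** Centres outside [A] are allowed: sums of two nets, as in [compact_mapD], need not lie in the
    image of the sum. *)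
Definition totally_bounded (A : set E) := forall e : R[i], 0 < e ->
  exists s : seq E, forall x, A x -> exists2 y, y \in s & `|x - y| <= e.

Lemma precompact_totally_bounded (A : set E) :
  precompact A -> totally_bounded A.
Proof.
move=> [U AU [+ _]] e e0; rewrite compact_cover => /(_ E setT (fun x => ball x e)).
case=> [x _|x Ux|D _ UD]; first exact: ball_open.
  by exists x => //; exact: ballxx.
exists (enum_fset D) => x Ax; have [y yD] := UD _ (AU _ Ax).
by rewrite -ball_normE /= => h; exists y => //; rewrite distrC ltW.
Qed.

(** An ultrafilter containing a finite union of balls contains one of them. With nets of every
    radius it is therefore Cauchy, and it converges by completeness. *)
Lemma totally_bounded_precompact (A : set E) :
  totally_bounded A -> precompact A.
Proof.
move=> tA; rewrite precompactE compact_ultra => F UF FA.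
have FB (e : R[i]) : 0 < e -> exists y, F (ball y e).
  move=> e0; have [|s sA] := tA (e / 4); first by rewrite divr_gt0.
  have {}sA x : closure A x -> exists2 y, y \in s & ball y e x.
    move=> /(_ (ball x (e / 4))) [|z [Az]].
      by apply: nbhsx_ballx; rewrite divr_gt0.
    rewrite -ball_normE /= => xz; have [y ys zy] := sA _ Az; exists y => //.
    rewrite distrC -(subrKA z) (le_lt_trans (ler_normD _ _)) //.
    apply: (lt_le_trans (ltr_leD xz zy)); rewrite -mulrDl ler_pdivrMr //.
    by rewrite -mulr2n -[e *+ 2]mulr_natr ler_pM2l // ler_nat.
  have : F [set x | exists2 y, y \in s & ball y e x] by apply: filterS FA => x /sA.
  elim: s {sA} => [|y s ih] h.
    by exfalso; apply: (@filter_not_empty _ F); apply: filterS h => x [].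
  have [Fy|Fy] := in_ultra_setVsetC (ball y e) UF; first by exists y.
  apply: ih; apply: filterS (filterI h Fy) => x [[z]].
  by rewrite inE => /orP[/eqP->//|zs] zx _; exists z.
have cF : cvg F by apply/cauchy_cvgP/cauchy_exP => e /FB.
exists (lim F); split => //.
apply: closed_closure => B /cF FB'.
by have [x] := filter_ex (filterI FA FB'); exists x.
Qed.

End TotallyBounded.

(** * Cauchy estimate for the iterates of [1 + z D] *)

Lemma iter_addZ_expand (K : comPzRingType) (V : lmodType K)
    (D : {linear V -> V}) (v : V) n :
  exists a : nat -> V, [/\ a 0%N = v, a 1%N = D v *+ n &
    forall z, iter n (fun u => u + z *: D u) v = \sum_(k < n.+1) z ^+ k *: a k].
Proof.
elim: n => [|n [a [a0 a1 aE]]].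
  exists (fun k => if k is 0 then v else 0); split=> // z.
  by rewrite big_ord1 scale1r.
(* The induction hypothesis leaves [a k] free for [k > n], so it is cut off there. *)
pose a' k := if (k <= n)%N then a k else 0.
exists (fun k => a' k + if k is k'.+1 then D (a k') else 0); split.
- by rewrite addr0 /a' leq0n.
- rewrite a0 mulrSr /a'; case: n a1 {a' aE} => [|n] a1 /=; last by rewrite a1.
  by rewrite mulr0n.
move=> z; rewrite iterS aE.
rewrite (eq_bigr (fun k : 'I_n.+2 => z ^+ k *: a' k +
    z ^+ k *: if nat_of_ord k is k'.+1 then D (a k') else 0)); last first.
  by move=> k _; rewrite scalerDr.
rewrite big_split /=; congr (_ + _).
  rewrite [RHS]big_ord_recr /= [a' n.+1]/a' ltnn scaler0 addr0.
  by apply: eq_bigr => k _; rewrite /a' -ltnS ltn_ord.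
rewrite [RHS]big_ord_recl /= scaler0 add0r linear_sum scaler_sumr.
by apply: eq_bigr => k _; rewrite linearZ /= scalerA -exprS.
Qed.

(* [N u a] stands for an upper bound [a] of a seminorm of [u].  [1 + z D] being an
   isometry to first order in every complex direction says that both [D] and
   [i D] are Hermitian.  Averaging [w^-1 (1 + t w D)^n v] over the [n.+1]-st
   roots of unity [w] isolates the linear term [n t D v]. *)
Lemma hermitian_skew_bound (R : realType) (V : lmodType R[i])
    (D : {linear V -> V}) (N : V -> R[i] -> Prop) (P : V -> Prop) (C : nat)
    (v : V) (c : R[i]) :
  (forall u a b, N u a -> a <= b -> N u b) ->
  N 0 0 ->
  (forall u w a b, N u a -> N w b -> N (u + w) (a + b)) ->
  (forall z u a, N u a -> N (z *: u) (`|z| * a)) ->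
  (forall u z a, P u -> 0 <= a -> N u a ->
    P (u + z *: D u) /\ N (u + z *: D u) ((1 + C%:R * `|z| ^+ 2) * a)) ->
  P v -> 0 <= c -> N v c -> forall e, 0 < e -> N (D v) e.
Proof.
move=> Nle N0 ND NZ step Pv c0 Nv e e0.
have [r rP] : exists r : nat, c * 2 / e < r%:R.
  by apply: complex_archimedean; rewrite divr_ge0 ?mulr_ge0 // ltW.
have r0 : 0 < r%:R :> R[i] by apply: le_lt_trans rP; rewrite divr_ge0 ?mulr_ge0 // ltW.
(* The [n] steps of size [t] have total length [r], and [n > 2 C r^2] gives [n C t^2 <= 1/2], so
   that the growth factor [(1 + C t^2)^n] is at most 2. The final bound on [D v] is [2 c / r], which
   the choice of [r] puts below [e]. *)
pose n := (2 * C * r ^ 2).+1; pose t : R[i] := r%:R / n%:R.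
have n0 : 0 < n%:R :> R[i] by rewrite ltr0n.
have t0 : 0 <= t by rewrite divr_ge0 ?ler0n.
(* The polynomial in [z] has degree at most [n], so [n.+1] roots of unity separate all its
   coefficients. *)
pose m := n.+1; have m0 : m%:R != 0 :> R[i] by rewrite pnatr_eq0.
have [w wm] := prim_root_exists m0.
have w1 : `|w| = 1.
  apply/eqP; rewrite -(@pexpr_eq1 _ _ m) // -normrX (prim_expr_order wm).
  by rewrite normr1.
pose x := C%:R * t ^+ 2; have x0 : 0 <= x by rewrite mulr_ge0 ?exprn_ge0.
have nx : n%:R * x <= 2^-1.
  rewrite /x /t exprMn exprVn.
  have -> : n%:R * (C%:R * (r%:R ^+ 2 / n%:R ^+ 2)) = (C * r ^ 2)%:R / n%:R :> R[i].
    by rewrite natrM natrX; field; rewrite gt_eqF.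
  rewrite ler_pdivrMr // -(ler_pM2l (ltr0n _ 2)) // mulrA divff ?pnatr_eq0 //.
  by rewrite mul1r -natrM ler_nat /n mulnA ltnW.
have xn : (1 + x) ^+ n <= 2.
  have h : 2^-1 <= 1 - n%:R * x.
    by rewrite lerBrDl -lerBrDr (le_trans nx) // (_ : 1 - 2^-1 = 2^-1) //; field.
  have h2 : 0 < 2^-1 :> R[i] by rewrite invr_gt0.
  rewrite -(ler_pM2r h2) divff ?pnatr_eq0 //.
  apply: le_trans (bernoulli_mul n (_ : -1 <= x)); last first.
    by apply: le_trans x0; rewrite oppr_le0.
  by rewrite ler_wpM2l // exprn_ge0 // addr_ge0.
have Nit z : `|z| = t -> forall k, 
    P (iter k (fun u => u + z *: D u) v) /\
    N (iter k (fun u => u + z *: D u) v) ((1 + x) ^+ k * c).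
  move=> zt; elim=> [|k [Pk Nk]]; first by rewrite mul1r.
  have := step _ z _ Pk _ Nk; rewrite mulr_ge0 ?exprn_ge0 ?addr_ge0 //.
  by rewrite zt -/x mulrA -exprS; apply.
have Nsum (I : finType) (F : I -> V) b : (forall i, N (F i) b) ->
    N (\sum_i F i) (\sum_(i : I) b).
  by move=> h; apply: (big_ind2 N) => // *; apply: ND.
have [a [_ a1 aE]] := iter_addZ_expand D v n.
have Nj (j : 'I_m) :
    N (w^-1 ^+ j *: iter n (fun u => u + (t * w ^+ j) *: D u) v) (2 * c).
  have zt : `|t * w ^+ j| = t by rewrite normrM normrX w1 expr1n mulr1 ger0_norm.
  have [_] := Nit _ zt n => /(NZ (w^-1 ^+ j)); rewrite normrX normfV w1 invr1 expr1n mul1r.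
  by move=> /Nle; apply; rewrite ler_wpM2r.
have := Nsum _ _ _ Nj.
have -> : \sum_(j < m) w^-1 ^+ j *: iter n (fun u => u + (t * w ^+ j) *: D u) v
    = (m%:R * t * n%:R) *: D v.
  under eq_bigr => j _ do rewrite aE scaler_sumr.
  rewrite exchange_big /=.
  have n1 : (1 < n.+1)%N by [].
  rewrite (bigD1 (Ordinal n1)) //= [X in _ + X]big1 ?addr0 => [|k k1].
    rewrite (eq_bigr (fun=> t *: a 1%N)) => [|j _]; last first.
      rewrite scalerA expr1 mulrCA -exprMn mulVf ?expr1n ?mulr1 //.
      by rewrite -normr_gt0 w1.
    by rewrite sumr_const card_ord a1 -[_ *+ m]scaler_nat -[D v *+ n]scaler_nat !scalerA.
  (* The power of [w] is [k - 1]. For [k = 0] it is [-1], that is [n] modulo [m]; otherwise it lies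
     strictly between 0 and [m]. Both sums vanish. *)
  have [k0|k0] := posnP k.
    under eq_bigr => j _ do rewrite k0 expr0 scale1r.
    rewrite -scaler_suml.
    have -> : \sum_(j < m) w^-1 ^+ j = \sum_(j < m) w ^+ j ^+ n.
      apply: eq_bigr => j _; rewrite exprAC; congr (_ ^+ _).
      apply: (mulfI (_ : w != 0)); first by rewrite -normr_gt0 w1.
      by rewrite -exprS (prim_expr_order wm) divff // -normr_gt0 w1.
    by rewrite (prim_root_sum _ wm) gtnNdvd // scale0r.
  under eq_bigr => j _ do rewrite scalerA.
  rewrite -scaler_suml.
  have -> : \sum_(j < m) w^-1 ^+ j * (t * w ^+ j) ^+ k =
      t ^+ k * \sum_(j < m) w ^+ j ^+ k.-1.
    rewrite mulr_sumr; apply: eq_bigr => j _; rewrite exprMn mulrCA; congr (_ * _).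
    rewrite -{1}(prednK k0) exprS mulrA -exprMn mulVf ?expr1n ?mul1r //.
    by rewrite -normr_gt0 w1.
  rewrite (prim_root_sum _ wm) gtnNdvd ?mulr0 ?scale0r //.
    by move: k1; rewrite -val_eqE /=; case: (nat_of_ord k) k0 => [|[]].
  by rewrite prednK // ltnW // ltn_ord.
rewrite sumr_const card_ord.
have -> : m%:R * t * n%:R = m%:R * r%:R :> R[i] by rewrite /t; field; rewrite gt_eqF.
move=> /(NZ (m%:R * r%:R)^-1); rewrite scalerA mulVf ?mulf_neq0 ?(gt_eqF r0) //.
rewrite scale1r => /Nle; apply.
rewrite ger0_norm ?invr_ge0 ?mulr_ge0 ?ler0n // -[2 * c *+ m]mulr_natl.
have -> : (m%:R * r%:R)^-1 * (m%:R * (2 * c)) = c * 2 / r%:R.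
  by field; rewrite m0 gt_eqF.
by rewrite ler_pdivrMr // [e * _]mulrC -ler_pdivrMr // ltW.
Qed.

(** * Compact maps and bounds on the essential norm *)

Section CompactMaps.
Variable R : realType.
Implicit Types E F G : hilbertType R.

Definition bounded_map E F (f : E -> F) :=
  exists2 k : R[i], 0 <= k & forall x, `|f x| <= k * `|x|.

(* Compactness for maps that need not be linear, hence the balls of all radii. *)
Definition compact_map E F (f : E -> F) :=
  forall r : R[i], totally_bounded (f @` [set x | `|x| <= r]).

Lemma compact_mapP E F (f : {linear E -> F}) : compact_op f <-> compact_map f.
Proof.
split=> [/precompact_totally_bounded tf r e e0|]; last first.
  by move=> cf; apply: totally_bounded_precompact; apply: cf.
(* A radius in [R[i]] need not be real. If no positive [k] dominates [r], the ball is empty, since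
   [|x| <= r] would make [r + 1] such a [k]. *)
have [[k k0] kr|nr] := pselect (exists2 k : R[i], 0 < k & r <= k); last first.
  exists [::] => _ [x /= xr <-]; exfalso; apply: nr; exists (r + 1).
    by rewrite ltr_wpDl // (le_trans _ xr).
  by rewrite lerDl.
have [|s sf] := tf (e / k); first by rewrite divr_gt0.
exists [seq k *: y | y <- s] => _ [x /= xr <-].
have [|y ys fy] := sf (f (k^-1 *: x)).
  exists (k^-1 *: x) => //=.
  by rewrite normrZ normfV gtr0_norm // ler_pdivrMl // mulr1 (le_trans xr).
exists (k *: y); first exact: map_f.
have -> : f x = k *: f (k^-1 *: x).
  by rewrite linearZ /= scalerA divff ?scale1r // gt_eqF.
by rewrite -scalerBr normrZ gtr0_norm // mulrC -ler_pdivlMr.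
Qed.

Lemma eq_compact_map E F (f g : E -> F) : f =1 g -> compact_map f -> compact_map g.
Proof. by move=> /funext ->. Qed.

Lemma compact_map0 E F : compact_map (fun _ : E => 0 : F).
Proof.
move=> r e e0; exists [:: 0] => _ [x _ <-].
by exists 0; rewrite ?inE // subrr normr0 ltW.
Qed.

Lemma compact_mapD E F (f g : E -> F) :
  compact_map f -> compact_map g -> compact_map (fun x => f x + g x).
Proof.
move=> cf cg r e e0; have e2 : 0 < e / 2 by rewrite divr_gt0.
have [s sf] := cf r _ e2; have [t tg] := cg r _ e2.
exists [seq y + z | y <- s, z <- t] => _ [x /= xr <-].
have [|y ys fy] := sf (f x); first by exists x.
have [|z zt gz] := tg (g x); first by exists x.
exists (y + z); first by apply/allpairsP; exists (y, z).
by rewrite opprD addrACA (le_trans (ler_normD _ _)) // [e]splitr lerD.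
Qed.

(** Without linearity, boundedness of the outer map does not carry nets to nets; a Lipschitz bound
    does. *)
Lemma compact_map_lipschitz E F G (f : E -> F) (g : F -> G) (k : R[i]) :
  0 <= k -> (forall x y, `|g x - g y| <= k * `|x - y|) ->
  compact_map f -> compact_map (fun x => g (f x)).
Proof.
move=> k0 gk cf r e e0; have k1 : 0 < k + 1 by rewrite ltr_wpDl.
have [|s sf] := cf r (e / (k + 1)); first by rewrite divr_gt0.
exists (map g s) => _ [x /= xr <-].
have [|y ys fy] := sf (f x); first by exists x.
exists (g y); first exact: map_f.
apply: (le_trans (gk _ _)); move: fy; rewrite ler_pdivlMr // => fy.
by rewrite (le_trans _ fy) // mulrC ler_wpM2l // lerDl.
Qed.

Lemma compact_map_compl E F G (f : E -> F) (g : boundedOp F G) :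
  compact_map f -> compact_map (fun x => g (f x)).
Proof.
have [k k0 gk] := bop_bounded_ge0 g.
by apply: (compact_map_lipschitz k0) => x y; rewrite -linearB.
Qed.

Lemma compact_mapZ E F (f : E -> F) a :
  compact_map f -> compact_map (fun x => a *: f x).
Proof.
apply: (@compact_map_lipschitz _ _ _ f ( *:%R a) `|a|) => // x y.
by rewrite -scalerBr normrZ.
Qed.

Lemma compact_mapN E F (f : E -> F) :
  compact_map f -> compact_map (fun x => - f x).
Proof.
by move/(compact_mapZ (-1)); apply: eq_compact_map => x; rewrite scaleN1r.
Qed.

Lemma compact_mapB E F (f g : E -> F) :
  compact_map f -> compact_map g -> compact_map (fun x => f x - g x).
Proof. by move=> cf /compact_mapN; apply: compact_mapD. Qed.

Lemma compact_map_compr E F G (f : F -> G) (g : E -> F) :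
  bounded_map g -> compact_map f -> compact_map (fun x => f (g x)).
Proof.
move=> [k k0 gk] cf r e e0; have [s sf] := cf (k * r) e e0.
exists s => _ [x /= xr <-]; apply: sf; exists (g x) => //=.
by rewrite (le_trans (gk _)) // ler_wpM2l.
Qed.

(* The essential norm of [f] is at most [c]; the infimum itself is never needed. *)
Definition ess_bound E F (f : E -> F) (c : R[i]) :=
  exists2 K, compact_map K & forall x, `|f x - K x| <= c * `|x|.

(** Norm limits of compact maps are compact: an [e/2]-net for an approximant within [e/2] of [f] on
    the ball is an [e]-net for [f]. *)
Lemma ess_bound0_compact E F (f : E -> F) :
  (forall e, 0 < e -> ess_bound f e) -> compact_map f.
Proof.
move=> fe r e e0.
have r0 : 0 < `|r| + 1 by rewrite ltr_wpDl.
have [|K cK fK] := fe (e / 2 / (`|r| + 1)); first by rewrite !divr_gt0.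
have [|s sK] := cK r (e / 2); first by rewrite divr_gt0.
exists s => _ [x /= xr <-].
have [|y ys Ky] := sK (K x); first by exists x.
exists y => //; rewrite -(subrKA (K x)) (le_trans (ler_normD _ _)) //.
rewrite [e]splitr lerD // (le_trans (fK _)) // mulrAC ler_pdivrMr //.
rewrite ler_wpM2l ?divr_ge0 ?(ltW e0) // (le_trans xr) //.
by rewrite ler_wpDr // real_ler_norm // ger0_real // (le_trans _ xr).
Qed.

Lemma ess_bound_le E F (f : E -> F) a b : ess_bound f a -> a <= b -> ess_bound f b.
Proof.
by move=> [K cK fK] ab; exists K => // x; rewrite (le_trans (fK x)) // ler_wpM2r.
Qed.

Lemma ess_boundD E F (f g : E -> F) a b :
  ess_bound f a -> ess_bound g b -> ess_bound (fun x => f x + g x) (a + b).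
Proof.
move=> [K cK fK] [L cL gL]; exists (fun x => K x + L x); first exact: compact_mapD.
by move=> x; rewrite opprD addrACA mulrDl (le_trans (ler_normD _ _)) // lerD.
Qed.

Lemma ess_boundZ E F (f : E -> F) z a :
  ess_bound f a -> ess_bound (fun x => z *: f x) (`|z| * a).
Proof.
move=> [K cK fK]; exists (fun x => z *: K x); first exact: compact_mapZ.
by move=> x; rewrite -scalerBr normrZ -mulrA ler_wpM2l.
Qed.

Lemma bounded_ess_bound E F (f : E -> F) (k : R[i]) :
  (forall x, `|f x| <= k * `|x|) -> ess_bound f k.
Proof.
by move=> fk; exists (fun=> 0) => [|x]; [exact: compact_map0|rewrite subr0].
Qed.

Lemma bounded_map_op E F (f : boundedOp E F) : bounded_map f.
Proof. by have [k] := bop_bounded_ge0 f; exists k. Qed.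

Lemma bounded_mapZ E F (f : E -> F) z :
  bounded_map f -> bounded_map (fun x => z *: f x).
Proof.
move=> [k k0 fk]; exists (`|z| * k); rewrite ?mulr_ge0 // => x.
by rewrite normrZ -mulrA ler_wpM2l.
Qed.

Lemma bounded_mapD E F (f g : E -> F) :
  bounded_map f -> bounded_map g -> bounded_map (fun x => f x + g x).
Proof.
move=> [k k0 fk] [l l0 gl]; exists (k + l); rewrite ?addr_ge0 // => x.
by rewrite mulrDl (le_trans (ler_normD _ _)) // lerD.
Qed.

Lemma bounded_mapB E F (f g : E -> F) :
  bounded_map f -> bounded_map g -> bounded_map (fun x => f x - g x).
Proof.
move=> bf [k k0 fk]; apply: bounded_mapD => //; exists k => // x.
by rewrite normrN.
Qed.

Lemma bounded_map_id E : bounded_map (@id E).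
Proof. by exists 1 => // x; rewrite mul1r. Qed.

Lemma bounded_map_comp E F G (f : F -> G) (g : E -> F) :
  bounded_map f -> bounded_map g -> bounded_map (fun x => f (g x)).
Proof.
move=> [k k0 fk] [l l0 gl]; exists (k * l); rewrite ?mulr_ge0 // => x.
by rewrite (le_trans (fk _)) // -mulrA ler_wpM2l.
Qed.

End CompactMaps.

(** * Fuglede-Putnam modulo compact operators *)

Section FugledePutnam.
Variable R : realType.
Implicit Types E F : hilbertType R.

Lemma adjointPr E F (T : boundedOp E F) x y :
  inner (adjoint T y) x = inner y (T x).
Proof. by rewrite innerC -adjointP -innerC. Qed.

Definition skew_part E (T : boundedOp E E) (z : R[i]) (x : E) : E :=
  z *: adjoint T x - z^* *: T x.

Lemma skew_partB E (T : boundedOp E E) z x y :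
  skew_part T z (x - y) = skew_part T z x - skew_part T z y.
Proof. by rewrite /skew_part !linearB /= !opprK addrACA. Qed.

Lemma skew_partN E (T : boundedOp E E) z x :
  skew_part T (- z) x = - skew_part T z x.
Proof. by rewrite /skew_part rmorphN /= !scaleNr opprD opprK. Qed.

(** For a skew-adjoint [Q] the number [inner x (Q x)] is purely imaginary, so the cross terms cancel
    and [1 + Q] is isometric to first order. *)
Lemma norm_addr_skew E (T : boundedOp E E) z x :
  `|x + skew_part T z x| ^+ 2 = `|x| ^+ 2 + `|skew_part T z x| ^+ 2.
Proof.
rewrite norm_innerD -[RHS]addr0; congr (_ + _).
rewrite /skew_part innerBr !innerZr /= -adjointP rmorphB !rmorphM /= !conjCK.
by rewrite -!innerC; ring.
Qed.

Lemma norm_subr_skew E (T : boundedOp E E) z x :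
  `|x - skew_part T z x| ^+ 2 = `|x| ^+ 2 + `|skew_part T z x| ^+ 2.
Proof. by rewrite -skew_partN norm_addr_skew skew_partN normrN. Qed.

Lemma norm_skew_le E (T : boundedOp E E) (k : R[i]) z x : 0 <= k ->
  (forall x, `|T x| <= k * `|x|) -> (forall x, `|adjoint T x| <= k * `|x|) ->
  `|skew_part T z x| <= 2 * k * `|z| * `|x|.
Proof.
move=> k0 Tk T'k; rewrite (le_trans (ler_normB _ _)) // !normrZ norm_conjC.
have -> : 2 * k * `|z| * `|x| = `|z| * (k * `|x|) + `|z| * (k * `|x|) by ring.
by rewrite lerD // ler_wpM2l.
Qed.

Lemma bounded_skew_part E (T : boundedOp E E) z : bounded_map (skew_part T z).
Proof. by apply: bounded_mapB; apply: bounded_mapZ; apply: bounded_map_op. Qed.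

Definition derivation E F (T : {linear F -> F}) (S : E -> E) (Y : E -> F) : E -> F :=
  fun x => T (Y x) - Y (S x).

(** Linearity in [Y], on the space of all functions, is what lets [hermitian_skew_bound] be applied
    with [V := E -> F]. *)
Fact derivation_is_linear E F (T : {linear F -> F}) (S : E -> E) :
  linear (@derivation E F T S).
Proof.
move=> a f g; apply/funext => x; rewrite /derivation.
by rewrite linearP opprD addrACA scalerBr.
Qed.

HB.instance Definition _ E F (T : {linear F -> F}) (S : E -> E) :=
  GRing.isLinear.Build R[i] (E -> F) (E -> F) _ (@derivation E F T S)
    (derivation_is_linear T S).

Lemma bounded_derivation E F (T : boundedOp F F) (S : boundedOp E E) (Y : E -> F) :
  bounded_map Y -> bounded_map (derivation T S Y).
Proof.
move=> bY; have bT := bounded_map_op T; have bS := bounded_map_op S.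
by apply: bounded_mapB; apply: bounded_map_comp.
Qed.

Lemma fuglede_putnam_compact E F (T : boundedOp F F) (S : boundedOp E E)
    (X : boundedOp E F) :
  compact_op (self_commutator T) -> compact_op (self_commutator S) ->
  compact_map (derivation T S X) ->
  compact_map (derivation (adjoint T) (adjoint S) X).
Proof.
move=> /compact_mapP cT /compact_mapP cS cX.
have [k k0 [Tk T'k Sk S'k]] : exists2 k : R[i], 0 <= k &
  [/\ forall x, `|T x| <= k * `|x|, forall x, `|adjoint T x| <= k * `|x|,
      forall x, `|S x| <= k * `|x| & forall x, `|adjoint S x| <= k * `|x|].
  have [k1 p1 h1] := bop_bounded_ge0 T; have [k2 p2 h2] := bop_bounded_ge0 (adjoint T).
  have [k3 p3 h3] := bop_bounded_ge0 S; have [k4 p4 h4] := bop_bounded_ge0 (adjoint S).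
  exists (k1 + k2 + (k3 + k4)); first by rewrite !addr_ge0.
  split=> x; [apply: le_trans (h1 x) _|apply: le_trans (h2 x) _|
              apply: le_trans (h3 x) _|apply: le_trans (h4 x) _];
    rewrite ler_wpM2r // -subr_ge0.
  - by rewrite (_ : _ - _ = k2 + (k3 + k4)) ?addr_ge0 //; ring.
  - by rewrite (_ : _ - _ = k1 + (k3 + k4)) ?addr_ge0 //; ring.
  - by rewrite (_ : _ - _ = k1 + k2 + k4) ?addr_ge0 //; ring.
  - by rewrite (_ : _ - _ = k1 + k2 + k3) ?addr_ge0 //; ring.
(* [a] serves as the constant [C] of [hermitian_skew_bound]: [Q] and [L] have norm at most
   [2 k |z|], and two errors [(2 k |z|)^2] add up to [8 k^2 |z|^2]. *)
have [a ka] : exists a : nat, 8 * k ^+ 2 < a%:R.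
  by apply: complex_archimedean; rewrite mulr_ge0 ?exprn_ge0.
have [c c0 Xc] := bop_bounded_ge0 X.
apply: ess_bound0_compact => e e0.
pose P (u : E -> F) := [/\ linear u, bounded_map u & compact_map (derivation T S u)].
apply: (@hermitian_skew_bound _ _ (derivation (adjoint T) (adjoint S))
  (@ess_bound R E F) P a _ c) e0 => //.
- exact: ess_bound_le.
- by apply: (@bounded_ess_bound _ _ _ (fun=> 0)) => x; rewrite normr0 mul0r.
- exact: ess_boundD.
- by move=> z u b ub; apply: ess_boundZ.
- move=> u z b [lu bu cu] b0 ub.
  have bD := bounded_derivation (adjoint T) (adjoint S) bu.
  have uB x y : u (x - y) = u x - u y.
    by rewrite -[- y]scaleN1r addrC lu scaleN1r addrC.
  have uZ d x : u (d *: x) = d *: u x.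
    have u0 : u 0 = 0 by have := uB 0 0; rewrite !subrr.
    by rewrite -[d *: x]addr0 lu u0 addr0.
  (* The derivations by [T], [S] and by their adjoints commute modulo compact maps, because the
     self-commutators are compact. Hence compactness of [T u - u S] survives the passage from [u] to
     [u + z D u]. *)
  have cDu : compact_map (derivation T S (derivation (adjoint T) (adjoint S) u)).
    apply: (@eq_compact_map _ _ _ (fun x => adjoint T (derivation T S u x) -
      derivation T S u (adjoint S x) - self_commutator T (u x)
      + u (self_commutator S x))).
      move=> x; rewrite /derivation /= !linearB /= uB.
      have W (V : zmodType) (a1 a2 a3 a4 a5 a6 : V) :
          a1 - a2 + (- a3 - - a4) + (- a1 - - a5) + (a6 - a4) = a5 - a3 + (- a2 - - a6).
        rewrite !opprK !addrA [LHS](ACl (1*5*(4*8)*(6*3*(2*7)))) /=.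
        by rewrite !subrr !add0r !addrA.
      exact: W.
    apply: compact_mapD; last first.
      have [l l0 ul] := bu.
      by apply: compact_map_lipschitz l0 _ cS => x y; rewrite -uB.
    apply: compact_mapB; last exact: compact_map_compr.
    apply: compact_mapB; first exact: compact_map_compl.
    by apply: compact_map_compr => //; apply: bounded_map_op.
  split.
    split; last first.
    - have -> : derivation T S (u + z *: derivation (adjoint T) (adjoint S) u) =
        derivation T S u + z *: derivation T S (derivation (adjoint T) (adjoint S) u).
        by rewrite linearD linearZ.
      by apply: compact_mapD => //; apply: compact_mapZ.
    - by apply: bounded_mapD => //; apply: bounded_mapZ.
    - move=> d x y.
      have E1 w : (u + z *: derivation (adjoint T) (adjoint S) u) w =
        u w + z *: (adjoint T (u w) - u (adjoint S w)) by [].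
      rewrite !E1 (linearP (adjoint S)) !lu (linearP (adjoint T)).
      rewrite opprD addrACA -scalerBr.
      set m1 := adjoint T (u x) - _; set m2 := adjoint T (u y) - _.
      by rewrite [in LHS]scalerDr addrACA [in RHS]scalerDr !scalerA [z * d]mulrC.
  have [K cK uK] := ub.
  pose Q := skew_part T z; pose L := skew_part S z.
  (* Exactly, [u + z D u = (1 + Q) u (1 - L) + Q u L + z^* (T u - u S)]; [K'] replaces [u] by [K] in
     the first two terms and keeps the compact third one. *)
  pose K' x := (K (x - L x) + Q (K (x - L x))) + Q (K (L x)) + z^* *: derivation T S u x.
  have bL : bounded_map (fun y => y - L y).
    by apply: bounded_mapB; [exact: bounded_map_id | exact: bounded_skew_part].
  have lipQ : forall y y', `|Q y - Q y'| <= 2 * k * `|z| * `|y - y'|.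
    by move=> y y'; rewrite -skew_partB norm_skew_le.
  have q0 : 0 <= 2 * k * `|z| by rewrite !mulr_ge0.
  exists K'.
    apply: compact_mapD; last exact: compact_mapZ.
    apply: compact_mapD; last first.
      apply: (compact_map_lipschitz q0 lipQ).
      by apply: compact_map_compr => //; apply: bounded_skew_part.
    apply: compact_mapD; first exact: compact_map_compr.
    by apply: (compact_map_lipschitz q0 lipQ); apply: compact_map_compr.
  move=> x.
  have -> : (u + z *: derivation (adjoint T) (adjoint S) u) x - K' x =
    ((u (x - L x) - K (x - L x)) + Q (u (x - L x) - K (x - L x))) +
    Q (u (L x) - K (L x)).
    have -> : (u + z *: derivation (adjoint T) (adjoint S) u) x =
        u (x - L x) + Q (u (x - L x)) + Q (u (L x)) + z^* *: derivation T S u x.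
      have -> : (u + z *: derivation (adjoint T) (adjoint S) u) x =
        u x + z *: (adjoint T (u x) - u (adjoint S x)) by [].
      rewrite uB /Q skew_partB -[X in _ = X + _]addrA subrK /L /skew_part /derivation uB !uZ.
      have W2 (V : zmodType) (a1 p q s r : V) :
          a1 + (p - q) = a1 - (q - r) + (p - s) + (s - r).
        rewrite !opprB !addrA [RHS](ACl (1*4*3*(6*5)*(2*7))) /=.
        by rewrite !subrr !addr0.
      by rewrite !scalerBr; apply: W2.
    have W3 (V : zmodType) (a1 a2 a3 a4 b2 b3 b5 : V) :
        a1 + a2 + a3 + a4 - (b5 + b2 + b3 + a4) = a1 - b5 + (a2 - b2) + (a3 - b3).
      rewrite !opprD !addrA [LHS](ACl (1*5*2*6*3*7*(4*8))) /=.
      by rewrite subrr addr0.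
    by rewrite /K' /Q !skew_partB; apply: W3.
  pose b1 := (2 * k * `|z|) ^+ 2.
  have Qle y : `|Q y| ^+ 2 <= b1 * `|y| ^+ 2.
    by rewrite -exprMn ler_pXn2r ?nnegrE ?mulr_ge0 // norm_skew_le.
  have Lle y : `|L y| ^+ 2 <= b1 * `|y| ^+ 2.
    by rewrite -exprMn ler_pXn2r ?nnegrE ?mulr_ge0 // norm_skew_le.
  have b10 : 0 <= b1 by rewrite exprn_ge0 ?mulr_ge0.
  (* Both [1 + Q] and [1 - L] have squared norm at most [1 + b1], so no term of first order in [|z|]
     appears. *)
  have h1 : `|(u (x - L x) - K (x - L x)) + Q (u (x - L x) - K (x - L x))|
      <= (1 + b1) * b * `|x|.
    rewrite -(@ler_pXn2r _ 2) ?nnegrE ?mulr_ge0 ?addr_ge0 // norm_addr_skew.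
    apply: (@le_trans _ _ ((1 + b1) * `|u (x - L x) - K (x - L x)| ^+ 2)).
      by rewrite mulrDl mul1r lerD2l.
    have -> : ((1 + b1) * b * `|x|) ^+ 2 = (1 + b1) * ((1 + b1) * b ^+ 2 * `|x| ^+ 2).
      by ring.
    rewrite ler_wpM2l ?addr_ge0 //.
    apply: (@le_trans _ _ ((b * `|x - L x|) ^+ 2)).
      by rewrite ler_pXn2r ?nnegrE ?mulr_ge0.
    rewrite exprMn [(1 + b1) * _]mulrC -[X in _ <= X]mulrA ler_wpM2l ?exprn_ge0 //.
    rewrite norm_subr_skew.
    by rewrite mulrDl mul1r lerD2l.
  have h2 : `|Q (u (L x) - K (L x))| <= b1 * b * `|x|.
    rewrite -(@ler_pXn2r _ 2) ?nnegrE ?mulr_ge0 // (le_trans (Qle _)) //.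
    have -> : (b1 * b * `|x|) ^+ 2 = b1 * (b1 * b ^+ 2 * `|x| ^+ 2) by ring.
    rewrite ler_wpM2l //.
    apply: (@le_trans _ _ ((b * `|L x|) ^+ 2)).
      by rewrite ler_pXn2r ?nnegrE ?mulr_ge0.
    by rewrite exprMn [b1 * _]mulrC -[X in _ <= X]mulrA ler_wpM2l ?exprn_ge0.
  rewrite (le_trans (ler_normD _ _)) // (le_trans (lerD h1 h2)) //.
  rewrite -mulrDl -mulrDl ler_wpM2r // ler_wpM2r // -addrA lerD2l.
  have -> : b1 + b1 = 8 * k ^+ 2 * `|z| ^+ 2 by rewrite /b1; ring.
  by rewrite ler_wpM2r ?exprn_ge0 // ltW.
- split => //; [exact: linearP | exact: bounded_map_op].
- exact: bounded_ess_bound.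
Qed.

End FugledePutnam.

(** * Uniform boundedness and projections onto ranges *)

Section Projection.
Variable R : realType.
Implicit Types E F G : hilbertType R.

(* Gliding hump: if [b n] in [B] grows fast enough, successive steps of length
   [3^-n] along [b n] sum to a vector [x] with [inner x (b n)] unbounded. *)
Lemma weakly_bounded_bounded E (B : set E) :
  (forall y, exists M : R[i], forall b, B b -> `|inner y b| <= M) ->
  exists2 C : R[i], 0 <= C & forall b, B b -> `|b| <= C.
Proof.
move=> wB; apply: contrapT => nB.
(* Here [3 ^+ n] offsets the step length [q n], and 4 offsets the factor [1 - 3/4] left after the
   later steps; [n.+1] remains and exceeds any bound. *)
have exb (n : nat) : exists b, B b /\ n.+1%:R * 4 * 3 ^+ n <= `|b|.
  apply: contrapT => nb; apply: nB.
  exists (n.+1%:R * 4 * 3 ^+ n); first by rewrite !mulr_ge0 ?exprn_ge0.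
  move=> y By; rewrite real_leNgt ?normr_real //; last first.
    by rewrite ger0_real // !mulr_ge0 ?exprn_ge0.
  by apply/negP => /ltW h; apply: nb; exists y.
have [b bP] := choice exb.
pose q n : R[i] := (3 ^+ n)^-1.
have q0 n : 0 < q n by rewrite invr_gt0 exprn_gt0.
have qS n : q n = 3 * q n.+1.
  by rewrite /q exprS invfM mulrA divff ?mul1r ?pnatr_eq0.
have exf (p : nat * E) : exists y, `|y - p.2| <= q p.1 /\
    q p.1 * `|b p.1| <= `|inner y (b p.1)|.
  case: p => n x /=.
  have b0 : 0 < `|b n|.
    by have [_] := bP n; apply: lt_le_trans; rewrite !mulr_gt0 ?exprn_gt0.
  pose d := (q n / `|b n|) *: b n.
  have nd : `|d| = q n.
    by rewrite normrZ gtr0_norm ?divr_gt0 // divfK ?gt_eqF.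
  have id : inner d (b n) = q n * `|b n|.
    by rewrite innerZl inner_norm; field; rewrite gt_eqF.
  (* One of [x + d] and [x - d] works, as their inner products with [b n] differ by
     [2 q n |b n|]. *)
  have [h|h] := boolP (q n * `|b n| <= `|inner (x + d) (b n)|).
    by exists (x + d); split=> //; rewrite addrC addKr nd.
  exists (x - d); split; first by rewrite addrC addKr normrN nd.
  have h2 : q n * `|b n| *+ 2 <= `|inner (x + d) (b n)| + `|inner (x - d) (b n)|.
    rewrite (_ : _ *+ 2 = `|inner (x + d) (b n) - inner (x - d) (b n)|); first exact: ler_normB.
    rewrite innerDl innerBl opprB addrC addrA subrK id -mulr2n normrMn.
    by rewrite ger0_norm // mulr_ge0 // ltW.
  rewrite -real_ltNge ?normr_real // in h; last by rewrite realM ?normr_real // gtr0_real.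
  move: h2; rewrite mulr2n => h2.
  rewrite -(lerD2l (q n * `|b n|)) (le_trans h2) // lerD2r.
  exact: ltW.
have [f fP] := choice exf.
pose x := fix x n := if n is m.+1 then f (m, x m) else 0.
have xd n m : `|x (n + m)%N - x n| <= 3 / 2 * (q n - q (n + m)%N).
  elim: m => [|m ih]; first by rewrite addn0 !subrr normr0 mulr0.
  rewrite -(subrKA (x (n + m)%N)) (le_trans (ler_normD _ _)) //.
  rewrite addnS /=; have [h _] := fP ((n + m)%N, x (n + m)%N).
  apply: (le_trans (lerD h ih)); rewrite /= (qS (n + m)%N).
  by rewrite le_eqVlt; apply/orP; left; apply/eqP; field.
have {}xd n m : (n <= m)%N -> `|x m - x n| <= 3 / 2 * q n.
  move=> /subnKC <-; rewrite (le_trans (xd _ _)) // ler_wpM2l ?divr_ge0 //.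
  by rewrite gerBl ltW.
have qlt (e : R[i]) : 0 < e -> exists n, q n < e.
  move=> e0; have [|n nP] := @complex_archimedean R e^-1; first by rewrite invr_ge0 ltW.
  exists n; rewrite /q -[e]invrK ltf_pV2 ?posrE ?invr_gt0 ?exprn_gt0 //.
  by rewrite (lt_trans nP) // -natrX ltr_nat ltn_expl.
have cx : cvg (x @ \oo).
  apply/cauchy_cvgP/cauchy_exP => e e0.
  have [|N qN] := qlt (e / 2); first by rewrite divr_gt0.
  exists (x N); exists N => // n /= Nn.
  rewrite -ball_normE /= distrC (le_lt_trans (xd _ _ Nn)) //.
  have : 3 / 2 * q N <= 2 * q N.
    by rewrite ler_pM2r // ler_pdivrMr // -natrM ler_nat.
  by move/le_lt_trans; apply; rewrite mulrC -ltr_pdivlMr.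
pose l := lim (x @ \oo).
(* The tail after [n.+1] is at most [3/2 q n.+1 = q n / 2]; another [q n / 4] pays for approximating
   the limit. *)
have lx n : `|l - x n.+1| <= 3 / 4 * q n.
  have e0 : 0 < q n / 4 by rewrite divr_gt0.
  have /cvgrPdist_lt/(_ _ e0)[M _ hM] := cx.
  have h1 := ltW (hM (maxn M n.+1) (leq_maxl _ _)).
  have h2 := xd _ _ (leq_maxr M n.+1).
  rewrite -(subrKA (x (maxn M n.+1))) (le_trans (ler_normD _ _)) //.
  apply: (le_trans (lerD h1 h2)); rewrite (qS n).
  by rewrite le_eqVlt; apply/orP; left; apply/eqP; field.
have [M lM] := wB l.
have M0 : 0 <= M by have [B0 _] := bP 0; apply: le_trans (lM _ B0).
have [n Mn] := complex_archimedean M0.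
have [Bn bn] := bP n; have [_ xn] := fP (n, x n).
have : q n * `|b n| <= M + 3 / 4 * q n * `|b n|.
  apply: (le_trans xn); rewrite /= -/(x n.+1).
  rewrite -[x n.+1](subKr l) innerBl (le_trans (ler_normB _ _)) //.
  apply: lerD; first exact: lM.
  by rewrite (le_trans (cauchy_schwarz _ _)) // ler_wpM2r.
rewrite -lerBlDr -mulrA -{1}[q n * _]mul1r -mulrBl.
have -> : 1 - 3 / 4 = 4^-1 :> R[i] by field.
rewrite ler_pdivrMl // => h.
have : q n * (n.+1%:R * 4 * 3 ^+ n) <= 4 * M.
  by apply: le_trans h; rewrite ler_wpM2l // ltW.
rewrite (_ : q n * _ = 4 * n.+1%:R); last by rewrite /q; field; rewrite expf_neq0 ?pnatr_eq0.
rewrite ler_pM2l // => /le_lt_trans/(_ Mn).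
by rewrite ltr_nat ltnNge leqnSn.
Qed.

Lemma coisometry_norm_le E F (X : boundedOp E F) x :
  isometric (adjoint X) -> `|X x| <= `|x|.
Proof.
move=> iX; have [->|X0] := eqVneq (X x) 0; first by rewrite normr0.
rewrite -(@ler_pM2r _ `|X x|) ?normr_gt0 // -[X in X <= _]expr2 -inner_norm.
rewrite adjointP (le_trans (real_ler_norm _)) //; last first.
  by rewrite (le_trans (cauchy_schwarz _ _)) // iX.
by rewrite -adjointP inner_norm rpredX // normr_real.
Qed.

(** With [J = adjoint X], expanding gives [|X J y - y|^2 = |X J y|^2 - |y|^2], which is at most 0
    because [X] is a contraction. *)
Lemma coisometryK E F (X : boundedOp E F) :
  isometric (adjoint X) -> cancel (adjoint X) X.
Proof.
move=> iX y; apply/eqP; rewrite -subr_eq0 -normr_eq0 -sqrf_eq0 eq_le exprn_ge0 // andbT.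
rewrite norm_innerB adjointP inner_norm rmorphXn /= (CrealP (normr_real _)) iX.
rewrite opprD addrA addrK subr_le0 ler_pXn2r ?nnegrE // -[X in _ <= X]iX.
exact: coisometry_norm_le.
Qed.

(** If [P y = X x], then [inner y (P u) = inner x (adjoint X u)]. So the vectors [P u] with
    [|adjoint X u| <= 1] are weakly bounded, hence bounded. *)
Lemma projection_adjoint_bound E F (X : boundedOp E F) (P : {linear F -> F}) :
  (forall x y, inner (P x) y = inner x (P y)) ->
  (forall y, exists x, X x = P y) ->
  exists2 C : R[i], 0 <= C & forall u, `|P u| <= C * `|adjoint X u|.
Proof.
move=> sP PX.
have [|C C0 CP] := @weakly_bounded_bounded F [set P u | u in [set u | `|adjoint X u| <= 1]].
  move=> y; have [x Xx] := PX y; exists `|x| => _ [u /= u1 <-].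
  rewrite -sP -Xx adjointP (le_trans (cauchy_schwarz _ _)) //.
  by rewrite -[X in _ <= X]mulr1 ler_wpM2l.
exists C => // u; have [Xu0|Xu0] := eqVneq (adjoint X u) 0.
  have -> : P u = 0.
    apply: inner_ext => z; have [x Xx] := PX z.
    by rewrite -sP -Xx adjointP Xu0 !inner0r.
  by rewrite normr0 mulr_ge0.
have a0 : 0 < `|adjoint X u| by rewrite normr_gt0.
have := CP (P (`|adjoint X u|^-1 *: u)); rewrite linearZ normrZ normfV normr_id.
rewrite ler_pdivrMl // [_ * C]mulrC; apply; exists (`|adjoint X u|^-1 *: u) => //=.
  by rewrite linearZ /= normrZ normfV normr_id mulVf // gt_eqF.
by rewrite linearZ.
Qed.

(* On the range of [P] the operator [X X*] is bounded below, so for small [a]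
   the map [1 - a X X*] is there a strict contraction, with which a bound for
   [W P] modulo compact maps can be improved. *)
Lemma compact_range_projection E F G (X : boundedOp E F) (P : {linear F -> F})
    (W : boundedOp F G) :
  (forall x y, inner (P x) y = inner x (P y)) ->
  (forall x, P (P x) = P x) ->
  (forall x, P (X x) = X x) ->
  (forall y, exists x, X x = P y) ->
  compact_map (fun x => W (X x)) -> compact_map (fun x => W (P x)).
Proof.
move=> sP PP PX XP cWX.
have P1 x : `|P x| <= `|x|.
  have [->|Px0] := eqVneq (P x) 0; first by rewrite normr0.
  rewrite -(@ler_pM2r _ `|P x|) ?normr_gt0 // -[X in X <= _]expr2 -inner_norm.
  rewrite sP PP (le_trans (real_ler_norm _)) ?cauchy_schwarz //.
  by rewrite -PP -sP inner_norm rpredX // normr_real.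
have bP : bounded_map P by exists 1 => // x; rewrite mul1r.
have [g g0 Xg] := bop_bounded_ge0 X.
have [C1 C10 CP] := projection_adjoint_bound sP XP.
pose C := C1 + 1; have C1C : 1 <= C by rewrite lerDr.
have C0 : 0 < C by apply: lt_le_trans C1C.
(* Small enough that [a ^+ 2 * |X h|^2 <= a * |h|^2]. *)
pose a := (1 + g ^+ 2)^-1.
have a0 : 0 < a by rewrite invr_gt0 ltr_pwDl ?exprn_ge0.
have ag : a * g ^+ 2 <= 1.
  by rewrite ler_pdivrMl ?ltr_pwDl ?exprn_ge0 // mulr1 lerDr.
have a1 : a <= 1.
  by rewrite invf_le1 ?ltr_pwDl ?exprn_ge0 // lerDl exprn_ge0.
(* With [k = P x] and [h = adjoint X k], [|L x|^2 <= |k|^2 - a |h|^2 <= (1 - 2 s) |k|^2 <= ((1 - s)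
   |k|)^2]; the middle step is [|k| <= C |h|]. *)
pose s := a / C ^+ 2 / 2.
have s0 : 0 < s by rewrite !divr_gt0 ?exprn_gt0.
have s1 : s <= 1.
  rewrite /s !ler_pdivrMr ?exprn_gt0 // mul1r (le_trans a1) //.
  by rewrite -[X in X <= _]mul1r ler_pM ?exprn_ege1 // ler1n.
pose L x := P x - a *: X (adjoint X (P x)).
have Ls x : `|L x| <= (1 - s) * `|x|.
  suff h : `|L x| <= (1 - s) * `|P x|.
    by rewrite (le_trans h) // ler_wpM2l ?subr_ge0.
  rewrite -(@ler_pXn2r _ 2) ?nnegrE ?mulr_ge0 ?subr_ge0 // /L.
  set k := P x; set h := adjoint X k.
  have aC : a^* = a by apply/CrealP; rewrite gtr0_real.
  have -> : `|k - a *: X h| ^+ 2 =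
      `|k| ^+ 2 - 2 * a * `|h| ^+ 2 + a ^+ 2 * `|X h| ^+ 2.
    rewrite norm_innerB innerZr /= aC -adjointPr inner_norm.
    rewrite rmorphM rmorphXn /= aC (CrealP (normr_real _)).
    rewrite normrZ gtr0_norm // exprMn; ring.
  have h1 : a ^+ 2 * `|X h| ^+ 2 <= a * `|h| ^+ 2.
    rewrite expr2 -mulrA ler_wpM2l ?(ltW a0) //.
    apply: (@le_trans _ _ (a * (g * `|h|) ^+ 2)).
      by rewrite ler_wpM2l ?(ltW a0) // ler_pXn2r ?nnegrE ?mulr_ge0.
    by rewrite exprMn mulrA -[X in _ <= X]mul1r ler_wpM2r ?exprn_ge0.
  have h2 : s * 2 * `|k| ^+ 2 <= a * `|h| ^+ 2.
    rewrite /s divfK ?pnatr_eq0 // -mulrA ler_wpM2l ?(ltW a0) //.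
    rewrite ler_pdivrMl ?exprn_gt0 // -exprMn ler_pXn2r ?nnegrE ?mulr_ge0 ?(ltW C0) //.
    rewrite /k -PP (le_trans (CP _)) // -/k -/h.
    by rewrite ler_wpM2r // lerDl.
  rewrite exprMn; apply: (@le_trans _ _ (`|k| ^+ 2 - s * 2 * `|k| ^+ 2)).
    rewrite -addrA lerD2l lerNr opprD opprK.
    apply: (le_trans h2); rewrite -subr_ge0.
    rewrite (_ : _ - _ = a * `|h| ^+ 2 - a ^+ 2 * `|X h| ^+ 2); last by ring.
    by rewrite subr_ge0.
  rewrite -[X in X - _]mul1r -mulrBl ler_wpM2r ?exprn_ge0 // -subr_ge0.
  rewrite (_ : _ - _ = s ^+ 2); last by ring.
  by rewrite exprn_ge0 // ltW.
have [w w0 Ww] := bop_bounded_ge0 W.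
have ess n : ess_bound (fun x => W (P x)) ((1 - s) ^+ n * w).
  elim: n => [|n [K cK WK]].
    rewrite mul1r; apply: bounded_ess_bound => x.
    by rewrite (le_trans (Ww _)) // ler_wpM2l.
  (* [W P] is [W P L] plus a multiple of [W X (adjoint X) P], which is compact; composing the error
     of [K] with [L] gains a factor [1 - s]. *)
  exists (fun x => K (L x) + a *: W (X (adjoint X (P x)))).
    apply: compact_mapD.
      by apply: compact_map_compr cK; exists (1 - s) => //; rewrite subr_ge0.
    apply: compact_mapZ; apply: compact_map_compr cWX.
    by apply: bounded_map_comp => //; apply: bounded_map_op.
  move=> x; have -> : W (P x) - (K (L x) + a *: W (X (adjoint X (P x)))) =
      W (P (L x)) - K (L x).
    have -> : P (L x) = L x by rewrite /L (linearB P) (linearZ_LR P) /= PP PX.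
    by rewrite {3}/L (linearB W) (linearZ_LR W) /= opprD addrA addrAC.
  rewrite (le_trans (WK _)) // exprSr -!mulrA ler_wpM2l ?exprn_ge0 ?subr_ge0 //.
  by rewrite mulrCA ler_wpM2l.
apply: ess_bound0_compact => e e0.
have [n nP] : exists n : nat, w / (s * e) < n%:R.
  by apply: complex_archimedean; rewrite divr_ge0 // mulr_ge0 // ltW.
apply: ess_bound_le (ess n) _.
(* Bernoulli at [-s] gives [(1 - s)^n (1 + n s) <= 1], while [w <= n s e]. *)
have : (1 - s) ^+ n * (1 - n%:R * - s) * e <= e.
  by rewrite -[X in _ <= X]mul1r ler_wpM2r ?(ltW e0) // bernoulli_mul // lerN2.
apply: le_trans; rewrite -mulrA ler_wpM2l ?exprn_ge0 ?subr_ge0 //.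
rewrite mulrN opprK mulrDl mul1r ler_wpDl ?(ltW e0) //.
by rewrite -mulrA -ler_pdivrMr ?(mulr_gt0 s0 e0) // ltW.
Qed.

End Projection.

(** * Compactness of the self-commutators on [M0] *)

Theorem theorem2 (R : realType) (A : assocAlg R[i])
    (M0 M1 M2 : hilbertModule A)
    (X0 : moduleMap M1 M0) (X1 : moduleMap M2 M1) :
  resolution1 X0 X1 ->
  essentially_reductive M1 ->
  essentially_reductive M2 ->
  isometric (adjoint X0) ->
  essentially_reductive M0.
Proof.
move=> [_ _ X1X0] er1 er2 iX0 a.
pose J := adjoint X0; pose T := hm_mul M1 a; pose S := hm_mul M2 a.
pose N := hm_mul M0 a.
have X0J : cancel J X0 := coisometryK iX0.
have X01 x : X0 (X1 x) = 0.
  have : range X1 (X1 x) by exists x.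
  by rewrite X1X0.
pose P : {linear M1 -> M1} := idfun \- (J \o X0).
have PE x : P x = x - J (X0 x) by [].
have NE y : N y = X0 (T (J y)) by rewrite mm_mul X0J.
(* This is the adjoint of the intertwining relation [X0 T = N X0]. *)
have JN y : J (adjoint N y) = adjoint T (J y).
  apply: inner_ext => z.
  by rewrite /J /T -!adjointP mm_mul.
have N'E y : adjoint N y = X0 (adjoint T (J y)) by rewrite -JN X0J.
have cX : compact_map (fun x => X0 (adjoint T (X1 x))).
  have c0 : compact_map (derivation T S X1).
    apply: eq_compact_map (@compact_map0 _ _ _) => x.
    by rewrite /derivation -mm_mul subrr.
  have c := fuglede_putnam_compact (er1 a) (er2 a) c0.
  apply: eq_compact_map (compact_map_compl X0 c) => x.
  by rewrite linearB /= X01 subr0.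
have [W WE] : exists W : boundedOp M1 M0, forall x, W x = X0 (adjoint T x).
  have bW : exists k : R[i], forall x, `|(X0 \o adjoint T) x| <= k * `|x|.
    have [k _ kP] := bounded_map_comp (bounded_map_op X0) (bounded_map_op (adjoint T)).
    by exists k.
  by exists (@BoundedOp _ M1 M0 (X0 \o adjoint T) bW).
have cP : compact_map (fun x => W (P x)).
  apply: (@compact_range_projection _ _ _ _ X1).
  - by move=> x y; rewrite !PE innerBl innerBr -adjointP adjointPr.
  - by move=> x; rewrite !PE linearB /= X0J subrr linear0 subr0.
  - by move=> x; rewrite PE X01 linear0 subr0.
  - move=> y; have Py : X0 (P y) = 0 by rewrite PE linearB /= X0J subrr.
    have : (X0 @^-1` [set 0]) (P y) by [].
    by rewrite -X1X0 => -[x _ <-]; exists x.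
  - by apply: eq_compact_map cX => x; rewrite WE.
apply/compact_mapP.
have /compact_mapP cT := er1 a.
apply: (@eq_compact_map _ _ _
  (fun y => X0 (self_commutator T (J y)) - W (P (T (J y))))).
  move=> y; rewrite WE PE.
  rewrite [RHS]/=.
  have -> : adjoint N (N y) = X0 (adjoint T (J (X0 (T (J y))))) by rewrite NE N'E.
  have -> : N (adjoint N y) = X0 (T (adjoint T (J y))) by rewrite NE JN.
  by rewrite !linearB /= opprK addrACA subrr add0r addrC.
apply: compact_mapB.
  by apply: compact_map_compr (compact_map_compl X0 cT); apply: bounded_map_op.
apply: compact_map_compr cP.
by apply: bounded_map_comp; apply: bounded_map_op.
Qed.
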